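(* A solution of the recurrence $$c_{j,k+1}=j^2c_{j,k}+j\,c_{j-1,k},\qquad k\geq 1,\; 1\leq j\leq k+1,$$ with $c_{0,k}=c_{k+1,k}=0$ for all $k\geq 1$ and $c_{1,1}=1$, is given by $$c_{j,k}=\frac{j!}{(2j-1)!}\left(\sum_{q=1}^{j}(-1)^{q+j}B_{j,q}\,q^{2k-1}\right),\qquad \text{for all } j\geq 1,\; k\geq j,$$ where $$B_{j,q}:=\frac{q}{j}\binom{2j}{j-q}.$$
   Context: The unknown is an array of numbers $c_{j,k}$ indexed by integers $k\geq 1$ and $0\leq j\leq k+1$, whose boundary entries are $c_{0,k}=c_{k+1,k}=0$. The numbers $B_{j,q}$, for integers $1\leq q\leq j$, constitute a Catalan triangle. *)

(* Defs.v *)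
From mathcomp Require Import all_boot all_order all_algebra.

Set Implicit Arguments.
Unset Strict Implicit.
Unset Printing Implicit Defensive.

Import GRing.Theory.
Local Open Scope ring_scope.

(* Catalan triangle, meant for 1 <= q <= j: the natural-number subtraction
   j - q is then exact and the division by j is genuine. *)
Definition catalanB (R : numFieldType) (j q : nat) : R :=
  q%:R / j%:R * 'C(2 * j, j - q)%:R.

(* An array (c_{j,k}), k >= 1 and 0 <= j <= k+1, is a function [c] with
   [c j k] standing for c_{j,k}; its values outside that index range are
   irrelevant and unconstrained. *)
Definition is_solution (R : numFieldType) (c : nat -> nat -> R) : Prop :=
  [/\ forall k : nat, (1 <= k)%N -> c 0%N k = 0 /\ c k.+1 k = 0,
      c 1%N 1%N = 1
    & forall j k : nat, (1 <= k)%N -> (1 <= j <= k.+1)%N ->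
        c j k.+1 = j%:R ^+ 2 * c j k + j%:R * c (j - 1)%N k].

(* Main.v *)
Require Import Defs.
From mathcomp Require Import all_boot all_order all_algebra.
From mathcomp Require Import ring zify.

(** The array defined by the closed formula for all [j] and [k] is itself the
    solution: no separate construction by recursion is needed.

    The recurrence holds separately for each base [q]. Multiplying the weight of
    [q ^ (2k-1)] in row [j] by [q^2 - j^2] gives [j] times its weight in row
    [j-1], because [(j-q)(j+q) C(2j, j-q) = 2j(2j-1) C(2j-2, j-1-q)]
    ([catalan_weight_rec]); for the new base [q = j] the factor
    [q^2 - j^2] vanishes. Summing gives [catalan_sum_rec].

    The substantial boundary condition is [c_{k+1,k} = 0]. More generally the
    formula vanishes whenever [1 <= k < j]. The recurrence expresses the value at
    [(j, k+1)] by those at [(j, k)] and [(j-1, k)], so induction on [k] reduces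
    this to [k = 1], that is, to
    [\sum_(1 <= q <= j) (-1)^q q^2 C(2j, j-q) = 0] for [j >= 2]. The summand has
    an explicit discrete primitive that vanishes at both ends
    ([alternating_square_bin_sum]). *)

Import GRing.Theory Num.Theory.
Local Open Scope ring_scope.

(** The factor multiplying [q ^ (2k-1)] in row [j]; it is independent of [k]. *)
Definition catalan_weight (R : numFieldType) (j q : nat) : R :=
  (j`!)%:R / ((2 * j - 1)`!)%:R * ((-1) ^+ (q + j) * catalanB R j q).

Definition catalan_sum (R : numFieldType) (j k : nat) : R :=
  (j`!)%:R / ((2 * j - 1)`!)%:R *
  \sum_(1 <= q < j.+1) (-1) ^+ (q + j) * catalanB R j q * q%:R ^+ (2 * k - 1).

Lemma catalan_sumE (R : numFieldType) (j k : nat) :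
  catalan_sum R j k =
  \sum_(1 <= q < j.+1) catalan_weight R j q * q%:R ^+ (2 * k - 1).
Proof.
by rewrite /catalan_sum mulr_sumr; apply: eq_bigr => q _; rewrite mulrA.
Qed.

(** Partial sums of [(-1)^q q^2 C(2j, j-q)]. The closed form comes from the
    discrete primitive [(-1)^q q(q-1) / ((j-q)! (j+q-1)!)]; its factor [j - n]
    makes the complete sum vanish, provided that the factor [j - 1] on the left
    can be cancelled. *)
Lemma alternating_square_bin_sum (R : numFieldType) (j n : nat) :
  (n <= j)%N ->
  2%:R * (j%:R - 1) *
    (\sum_(1 <= q < n.+1) (-1) ^+ q * q%:R ^+ 2 * 'C(2 * j, j - q)%:R) =
  (-1) ^+ n * (n%:R * (n%:R + 1) * (j%:R - n%:R)) * 'C(2 * j, j - n)%:R :> R.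
Proof.
elim: n => [|n IHn] le_nj; first by rewrite big_geq // mulr0 !mul0r mulr0 mul0r.
rewrite big_nat_recr //= mulrDr IHn ?(ltnW le_nj) //.
have bin_step : (j%:R - n%:R) * 'C(2 * j, j - n)%:R =
    (j%:R + n%:R + 1) * 'C(2 * j, j - n.+1)%:R :> R.
  rewrite -natrB ?(ltnW le_nj) // -!natrD natr1 -!natrM.
  congr (_%:R).
  have := mul_bin_left (2 * j) (j - n.+1).
  have -> : ((j - n.+1).+1 = j - n)%N by lia.
  by have -> : (2 * j - (j - n.+1) = (j + n).+1)%N by lia.
have -> : (-1) ^+ n * (n%:R * (n%:R + 1) * (j%:R - n%:R)) * 'C(2 * j, j - n)%:R =
  (-1) ^+ n * (n%:R * (n%:R + 1)) * ((j%:R - n%:R) * 'C(2 * j, j - n)%:R) :> R.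
  by ring.
by rewrite bin_step exprS -(natr1 n); ring.
Qed.

(** The binomial identity is the removal of one factor from each of the two
    factorials in the denominator of [C(2p+2, p+1-q)]. *)
Lemma central_bin_shift (p q : nat) : (q <= p)%N ->
  ((p.+1 - q) * (p.+1 + q) * 'C(2 * p.+1, p.+1 - q) =
   2 * p.+1 * (2 * p).+1 * 'C(2 * p, p - q))%N.
Proof.
move=> le_qp.
have diag := mul_bin_diag (2 * p).+2 (p - q).
have down := mul_bin_down (2 * p).+1 (p - q).
rewrite /= in diag down.
have e1 : ((p - q).+1 = p.+1 - q)%N by lia.
have e2 : ((2 * p).+1 - (p - q) = p.+1 + q)%N by lia.
have e3 : ((2 * p).+2 = 2 * p.+1)%N by lia.
rewrite e1 e3 in diag; rewrite e2 in down.
by rewrite mulnAC -diag -!mulnA down; ring.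
Qed.

Lemma catalan_weight_rec (R : numFieldType) (p q : nat) :
  (0 < p)%N -> (q <= p)%N ->
  (q%:R ^+ 2 - p.+1%:R ^+ 2) * catalan_weight R p.+1 q =
  p.+1%:R * catalan_weight R p q.
Proof.
move=> p_gt0 le_qp; rewrite /catalan_weight /catalanB.
have shift := congr1 (fun n : nat => n%:R : R) (central_bin_shift _ _ le_qp).
rewrite /= !natrM natrB ?(leqW le_qp) // natrD in shift.
have -> : (2 * p.+1 - 1 = (2 * p - 1).+2)%N by lia.
have fact_step : (((2 * p - 1).+2)`!%:R =
    (2 * p).+1%:R * ((2 * p)%:R * (2 * p - 1)`!%:R) :> R).
  by rewrite -!natrM !factS; have -> : ((2 * p - 1).+1 = 2 * p)%N by lia.
rewrite fact_step factS natrM addnS (exprS _ (q + p)).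
have p_neq0 : p%:R != 0 :> R by rewrite pnatr_eq0 -lt0n.
have p1_neq0 : p.+1%:R != 0 :> R by rewrite pnatr_eq0.
have odd_neq0 : (2 * p).+1%:R != 0 :> R by rewrite pnatr_eq0.
have fact_neq0 : (2 * p - 1)`!%:R != 0 :> R by rewrite pnatr_eq0 -lt0n fact_gt0.
move: fact_neq0 p_neq0 p1_neq0 odd_neq0 shift.
rewrite natrM.
move: (p.+1%:R) ((2 * p).+1%:R) ((2 * p - 1)`!%:R) ('C(2 * p.+1, _)%:R)
  ('C(2 * p, _)%:R) ((-1) ^+ (q + p)) (p`!%:R) (p%:R : R)
  (q%:R : R) =>
  x y z b b' e f r s z0 r0 x0 y0 shift.
(* Solving [shift] for [b'] turns the goal into an identity of rational
   functions, in which [x] and [r] may be treated as independent. *)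
have -> : b' = (x - s) * (x + s) * b / (2%:R * x * y).
  rewrite shift; field.
  by rewrite x0 y0.
field.
by rewrite z0 r0 x0 y0.
Qed.

Lemma catalan_sum0 (R : numFieldType) (k : nat) : catalan_sum R 0 k = 0.
Proof. by rewrite /catalan_sum big_geq // mulr0. Qed.

Lemma catalan_sum_rec (R : numFieldType) (p k : nat) : (0 < k)%N ->
  catalan_sum R p.+1 k.+1 =
  p.+1%:R ^+ 2 * catalan_sum R p.+1 k + p.+1%:R * catalan_sum R p k.
Proof.
move=> k_gt0; rewrite !catalan_sumE.
have -> : (2 * k.+1 - 1 = 2 + (2 * k - 1))%N by lia.
rewrite [in LHS]big_nat_recr // [X in _ ^+ 2 * X]big_nat_recr //= mulrDr.
rewrite addrAC !mulr_sumr -big_split /=; congr (_ + _); last first.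
  by rewrite exprD; ring.
apply: eq_big_nat => q /andP[q_gt0]; rewrite ltnS => le_qp.
have p_gt0 := leq_trans q_gt0 le_qp.
rewrite [in RHS](mulrA p.+1%:R) -catalan_weight_rec // exprD; ring.
Qed.

Lemma catalan_sum_first_column (R : numFieldType) (j : nat) : (1 < j)%N ->
  catalan_sum R j 1 = 0.
Proof.
move=> j_gt1.
have j1_neq0 : 2%:R * (j%:R - 1) != 0 :> R.
  by rewrite mulf_neq0 ?pnatr_eq0 // subr_eq0 pnatr_eq1; lia.
have := alternating_square_bin_sum R j j (leqnn j).
rewrite subrr mulr0 mulr0 mul0r => /eqP.
rewrite mulf_eq0 (negPf j1_neq0) /= => /eqP sum0.
rewrite /catalan_sum.
rewrite (eq_bigr (fun q => (-1) ^+ j / j%:R *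
  ((-1) ^+ q * q%:R ^+ 2 * 'C(2 * j, j - q)%:R))) => [|q _].
  by rewrite -mulr_sumr sum0 !mulr0.
by rewrite /catalanB exprD; ring.
Qed.

(** The region [0 < k < j] is stable: if [k + 1 < j], then the two entries in
    rows [j] and [j - 1] of column [k] lie in it as well. *)
Lemma catalan_sum_vanish (R : numFieldType) (j k : nat) :
  (0 < k)%N -> (k < j)%N -> catalan_sum R j k = 0.
Proof.
elim: k j => // -[_ j _|k IHk [|j] // _ lt_kj].
  exact: catalan_sum_first_column.
by rewrite catalan_sum_rec // !IHk ?mulr0 ?addr0 // ltnW.
Qed.

Theorem theorem2p2 (R : numFieldType) :
  exists c : nat -> nat -> R,
    is_solution c /\
    (forall j k : nat, (1 <= j)%N -> (j <= k)%N ->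
       c j k = (j`!)%:R / ((2 * j - 1)`!)%:R *
               \sum_(1 <= q < j.+1)
                  (-1) ^+ (q + j) * catalanB R j q * q%:R ^+ (2 * k - 1)).
Proof.
exists (catalan_sum R); split=> //; split.
- by move=> k k_gt0; rewrite catalan_sum0 catalan_sum_vanish.
- rewrite /catalan_sum big_nat1 /catalanB bin0 /=.
  by rewrite !divr1 expr2 mulrNN !mulr1.
- by move=> [|j] k // k_gt0 _; rewrite subn1 /= catalan_sum_rec.
Qed.
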